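(* Let $A\in\mathbb{Z}^{d\times n}$ be an integer matrix with columns $a_1,\dots,a_n$ such that the lattice generated by $a_1,\dots,a_n$ is $\mathbb{Z}^d$ and there exists $c\in\mathbb{Q}^d$ with $c\cdot a_i>0$ for $i=1,\dots,n$. Let $H$ be the set of holes, let $B=\{b_1,\dots,b_L\}$ be the minimal Hilbert basis of the cone $K$ generated by $a_1,\dots,a_n$, and let $\bar\mu_{li}$ be as defined in the context. Then $H$ is finite if and only if $\bar\mu_{li}<\infty$ for all $l=1,\dots,L$ and all $i=1,\dots,n$.
   Context: $\mathbb{N}=\{0,1,2,\dots\}$. $Q=\{\sum_{i=1}^n x_i a_i : x_i\in\mathbb{N}\}$, $K=\{\sum_{i=1}^n x_i a_i: x_i\in\mathbb{R}_{\ge 0}\}$, and $Q_{\rm sat}=K\cap\mathbb{Z}^d$ (the lattice generated by the $a_i$ being $\mathbb{Z}^d$). The set of holes is $H=Q_{\rm sat}\setminus Q$. A Hilbert basis of the cone $K$ is a finite subset $B\subset K\cap\mathbb{Z}^d$ such that every integral point of $K$ is a nonnegative integral linear combination of elements of $B$; it is minimal if it is minimal with respect to inclusion. Since $K$ is a pointed rational polyhedral cone, it has a unique minimal Hilbert basis, written $B=\{b_1,\dots,b_L\}$ (here $L$ denotes the number of its elements). For $l\in\{1,\dots,L\}$ and $i\in\{1,\dots,n\}$ define $\bar\mu_{li}=\min\{\lambda\in\mathbb{Z}: b_l+\lambda a_i\in Q\}$ if there is some $\lambda\in\mathbb{Z}$ with $b_l+\lambda a_i\in Q$, and $\bar\mu_{li}=\infty$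 otherwise. *)

(* Defs.v *)
From mathcomp Require Import all_boot all_order all_algebra finmap.
From mathcomp Require Import boolp classical_sets cardinality reals.
From mathcomp Require Import constructive_ereal.

Set Implicit Arguments.
Unset Strict Implicit.
Unset Printing Implicit Defensive.

Import Order.TTheory GRing.Theory Num.Theory.

Local Open Scope classical_set_scope.
Local Open Scope ring_scope.

Definition lattice d n (A : 'M[int]_(d, n)) : set 'cV[int]_d :=
  [set v | exists x : 'I_n -> int, v = \sum_(i < n) col i A *~ x i].

Definition semigroup d n (A : 'M[int]_(d, n)) : set 'cV[int]_d :=
  [set v | exists x : 'I_n -> nat, v = \sum_(i < n) col i A *+ x i].

Definition cone (R : realType) d n (A : 'M[int]_(d, n)) : set 'cV[R]_d :=
  [set v | exists x : 'I_n -> R, (forall i, 0 <= x i) /\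
     v = \sum_(i < n) x i *: map_mx intr (col i A)].

(* The integral points K `&` Z^d of the cone, as vectors over int. When
   lattice A = setT this is also the saturation Q_sat of the semigroup. *)
Definition cone_int (R : realType) d n (A : 'M[int]_(d, n)) :
    set 'cV[int]_d :=
  [set v | cone A (map_mx intr v : 'cV[R]_d)].

Definition holes (R : realType) d n (A : 'M[int]_(d, n)) : set 'cV[int]_d :=
  cone_int R A `\` semigroup A.

Definition Hilbert_basis (R : realType) d n (A : 'M[int]_(d, n))
    (B : {fset 'cV[int]_d}) : Prop :=
  [set` B] `<=` cone_int R A /\
  forall v, cone_int R A v ->
    exists x : 'cV[int]_d -> nat, v = \sum_(b <- B) b *+ x b.

Definition minimal_Hilbert_basis (R : realType) d n (A : 'M[int]_(d, n))
    (B : {fset 'cV[int]_d}) : Prop :=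
  Hilbert_basis R A B /\
  forall B' : {fset 'cV[int]_d},
    Hilbert_basis R A B' -> (B' `<=` B)%fset -> B' = B.

Definition shifts d n (A : 'M[int]_(d, n)) (b : 'cV[int]_d) (i : 'I_n) :
    set int :=
  [set l | semigroup A (b + col i A *~ l)].

Definition is_min (S : set int) : set int :=
  [set m | S m /\ forall l, S l -> m <= l].

(* The default 0 of xget is returned only if shifts A b i is nonempty and
   unbounded below, which does not happen when some linear form is positive
   on all the columns of A (see is_min_shifts). *)
Definition mu_bar d n (A : 'M[int]_(d, n)) (b : 'cV[int]_d) (i : 'I_n) :
    \bar int :=
  if `[< exists l, shifts A b i l >]
  then (xget 0 (is_min (shifts A b i)))%:E
  else +oo%E.

(* The set [set l | 0 <= \sum_k c_k (b_k + l a_ki)] containing shifts A b i is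
   bounded below. *)
Lemma is_min_shifts d n (A : 'M[int]_(d, n)) (c : 'cV[rat]_d) b i :
  (forall j, 0 < \sum_(k < d) c k 0 * (A k j)%:~R) ->
  (exists l, shifts A b i l) ->
  is_min (shifts A b i) (xget 0 (is_min (shifts A b i))).
Proof.
move=> cA [l0 Sl0].
pose f (v : 'cV[int]_d) : rat := \sum_(k < d) c k 0 * (v k 0)%:~R.
have fD u v : f (u + v) = f u + f v.
  rewrite /f -big_split /=; apply: eq_bigr => k _.
  by rewrite mxE rmorphD mulrDr.
have f0 : f 0 = 0 by rewrite /f big1// => k _; rewrite mxE mulr0.
have fn u m : f (u *+ m) = f u *+ m.
  by elim: m => [|m IH]; rewrite ?mulr0n// !mulrS fD IH.
have fN u : f (- u) = - f u.
  by apply/eqP; rewrite -addr_eq0 -fD addNr f0.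
have fz u (z : int) : f (u *~ z) = f u *~ z.
  by case: z => m; rewrite ?NegzE ?mulrNz ?fN -!pmulrn fn.
have fcol j : f (col j A) = \sum_(k < d) c k 0 * (A k j)%:~R.
  by apply: eq_bigr => k _; rewrite mxE.
have fQ v : semigroup A v -> 0 <= f v.
  move=> [x ->]; rewrite (big_morph f fD f0); apply: sumr_ge0 => j _.
  by rewrite fn mulrn_wge0// fcol ltW.
pose a := f (col i A).
have a0 : 0 < a by rewrite /a fcol.
pose N := Num.truncn (`|f b| / a).
have lb l : shifts A b i l -> - (N.+1)%:Z <= l.
  move=> /fQ; rewrite fD fz -/a => h.
  rewrite -(ler_int rat) -(ler_pM2r a0) rmorphN /= mulNr lerNl.
  rewrite -mulNr mulrC mulrN mulrzr.
  have h1 : - (a *~ l) <= `|f b|.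
    by apply: le_trans (ler_norm _); rewrite -subr_ge0 opprK.
  apply: (le_trans h1); rewrite -ler_pdivrMr//.
  exact: ltW (truncnS_gt _).
have [m hm mmin] : exists2 m : nat, shifts A b i (m%:Z - N.+1%:Z) &
    forall k : nat, shifts A b i (k%:Z - N.+1%:Z) -> (m <= k)%N.
  have ex : exists m : nat, `[< shifts A b i (m%:Z - N.+1%:Z) >].
    exists `|(l0 + N.+1%:Z)%R|%N; apply/asboolP.
    by rewrite gez0_abs ?addrK// -lerBlDr sub0r lb.
  exists (ex_minn ex); first by case: ex_minnP => m /asboolP.
  by case: ex_minnP => m _ H k /asboolP; exact: H.
apply: (@xgetPex _ 0 (is_min _)); exists (m%:Z - N.+1%:Z); split=> // l Sl.
have lN : 0 <= l + N.+1%:Z by rewrite -lerBlDr sub0r lb.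
rewrite lerBlDr -(gez0_abs lN) lez_nat mmin//.
by rewrite gez0_abs// addrK.
Qed.

(* Main.v *)
Require Import Defs.
From mathcomp Require Import all_boot all_order all_algebra finmap.
From mathcomp Require Import boolp classical_sets cardinality reals.
From mathcomp Require Import constructive_ereal.

Set Implicit Arguments.
Unset Strict Implicit.
Unset Printing Implicit Defensive.

Import Order.TTheory GRing.Theory Num.Theory.

Local Open Scope classical_set_scope.
Local Open Scope ring_scope.

(** If [H] is finite, the infinitely many points [b + l a_i] ([l] natural) of
    [K] cannot all be holes. Conversely, if every element of [B] is carried
    into [Q] by adding multiples of any [a_i], then so is every integral point
    of [K], as a sum of elements of [B]. Rounding down the coefficients of a
    hole [v = \sum_i y_i a_i] leaves a remainder [r] in the finite set of
    integral points of the zonotope [\sum_i [0, 1] a_i]; as [v] is not in [Q],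
    each [floor y_i] is less than the number of copies of [a_i] that carries
    [r] into [Q], so [v] lies in a bounded set. *)

Lemma finite_int_box d (D : nat) :
  finite_set [set v : 'cV[int]_d | forall k, `|v k 0| <= D%:Z].
Proof.
(* Translating by [D] moves the coordinates into [0, ..., 2D], so the box is an image of a finite
   type. *)
pose f (w : 'cV['I_(D.*2.+1)]_d) : 'cV[int]_d :=
  \col_k ((w k 0 : nat)%:Z - D%:Z).
apply: (@sub_finite_set _ _ (f @` setT)); last first.
  by apply: finite_image; exact: finite_finset.
move=> v /= vD; exists (\col_k inord `|(v k 0 + D%:Z)%R|%N) => //.
apply/colP => k; rewrite !mxE.
have /andP[v1 v2] : - D%:Z <= v k 0 <= D%:Z by rewrite -ler_norml.
have v0 : 0 <= v k 0 + D%:Z by rewrite -lerBlDr sub0r.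
rewrite inordK; first by rewrite gez0_abs// addrK.
by rewrite ltnS -lez_nat gez0_abs// -addnn PoszD lerD2r.
Qed.

Lemma finite_set_uniform_bound (T : choiceType) (F : set T)
    (P : T -> nat -> Prop) :
  finite_set F ->
  (forall x m m', (m <= m')%N -> P x m -> P x m') ->
  (forall x, F x -> exists m, P x m) ->
  exists m, forall x, F x -> P x m.
Proof.
move=> finF Pmono FP.
have /choice[f fP] : forall x, exists m, F x -> P x m.
  move=> x; have [Fx|nFx] := pselect (F x); last by exists 0%N.
  by have [m Pm] := FP x Fx; exists m.
exists (\max_(x <- fset_set F) f x)%N => x Fx.
apply: Pmono (fP x Fx); apply: leq_bigmax_seq => //.
by rewrite in_fset_set// inE.
Qed.

Section Semigroup.
Variables (d n : nat) (A : 'M[int]_(d, n)).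

Lemma semigroup0 : semigroup A 0.
Proof. by exists (fun=> 0%N); rewrite big1. Qed.

Lemma semigroupD u v : semigroup A u -> semigroup A v -> semigroup A (u + v).
Proof.
move=> [x ->] [y ->]; exists (fun i => (x i + y i)%N).
by rewrite -big_split /=; apply: eq_bigr => i _; rewrite mulrnDr.
Qed.

Lemma semigroup_col i m : semigroup A (col i A *+ m).
Proof.
exists (fun j => if j == i then m else 0%N).
rewrite (bigD1 i)//= eqxx big1 ?addr0// => j /negPf ->.
by rewrite mulr0n.
Qed.

(** One natural [m] serves every column, each added separately; this makes the property monotone in
    [m] and additive in [v]. *)
Definition absorbed (v : 'cV[int]_d) (m : nat) : Prop :=
  forall i, semigroup A (v + col i A *+ m).

Lemma absorbed_leq v m m' : (m <= m')%N -> absorbed v m -> absorbed v m'.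
Proof.
move=> mm' vm i; rewrite -(subnKC mm') mulrnDr addrA.
by apply: semigroupD; [exact: vm|exact: semigroup_col].
Qed.

Lemma absorbed0 : absorbed 0 0.
Proof. by move=> i; rewrite mulr0n addr0; exact: semigroup0. Qed.

Lemma absorbedD u v m m' :
  absorbed u m -> absorbed v m' -> absorbed (u + v) (m + m').
Proof.
by move=> um vm i; rewrite mulrnDr addrACA; apply: semigroupD.
Qed.

Lemma absorbed_span (B : {fset 'cV[int]_d}) (x : 'cV[int]_d -> nat) :
  (forall b, b \in B -> exists m, absorbed b m) ->
  exists m, absorbed (\sum_(b <- B) b *+ x b) m.
Proof.
move=> BP; rewrite big_seq.
apply: (big_ind (fun v => exists m, absorbed v m)).
- by exists 0%N; exact: absorbed0.
- by move=> u v [m um] [m' vm]; exists (m + m')%N; exact: absorbedD.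
- move=> b /BP[m bm]; elim: (x b) => [|k [m' IH]].
    by exists 0%N; rewrite mulr0n; exact: absorbed0.
  by exists (m + m')%N; rewrite mulrS; exact: absorbedD.
Qed.

Lemma absorbed_shifts b :
  (forall i, exists l, shifts A b i l) -> exists m, absorbed b m.
Proof.
(* The shifts [l i] may be negative and differ with [i]; the maximum of their absolute values
   exceeds each of them by a natural number of copies of [col i A]. *)
move=> /choice[l bl]; exists (\max_i `|l i|)%N => i.
set m := (\max_i _)%N.
have lm : 0 <= m%:Z - l i.
  by rewrite subr_ge0 (le_trans (ler_norm _))// -abszE lez_nat leq_bigmax.
have -> : b + col i A *+ m =
    (b + col i A *~ l i) + col i A *+ `|(m%:Z - l i)%R|%N.
  by rewrite -addrA pmulrn pmulrn gez0_abs// -mulrzDr subrKC.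
by apply: semigroupD; [exact: bl|exact: semigroup_col].
Qed.

Lemma mu_bar_lty b i :
  (mu_bar A b i < +oo)%E <-> exists l, shifts A b i l.
Proof.
rewrite /mu_bar; case: asboolP => h; split => //.
by rewrite ltey.
Qed.

Variable R : realType.

Lemma cone_int_shift b i m : cone_int R A b -> cone_int R A (b + col i A *+ m).
Proof.
move=> [x [x0 bx]]; exists (fun j => x j + (if j == i then m%:R else 0)).
split=> [j|]; first by rewrite addr_ge0//; case: ifP.
rewrite raddfD /= bx raddfMn /=.
under [RHS]eq_bigr do rewrite scalerDl.
rewrite big_split /=; congr (_ + _).
rewrite (bigD1 i)//= eqxx big1 ?addr0 ?scaler_nat// => j /negPf ->.
by rewrite scale0r.
Qed.

Lemma cone_coord (y : 'I_n -> R) (v : 'cV[int]_d) k :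
  map_mx intr v = \sum_(i < n) y i *: map_mx intr (col i A) ->
  (v k 0)%:~R = \sum_(i < n) y i * (A k i)%:~R.
Proof.
move=> /colP/(_ k); rewrite mxE => ->; rewrite summxE.
by apply: eq_bigr => i _; rewrite !mxE.
Qed.

Lemma cone_coord_bound (y : 'I_n -> R) (v : 'cV[int]_d) (M : nat) :
  (forall i, 0 <= y i <= M%:R) ->
  map_mx intr v = \sum_(i < n) y i *: map_mx intr (col i A) ->
  forall k, `|v k 0| <= (\sum_(j < d) \sum_(i < n) M * `|A j i|)%N%:Z.
Proof.
(* The triangle inequality bounds coordinate [k] by the row [k] term; summing over all rows gives a
   bound independent of [k]. *)
move=> yM vy k; rewrite (bigD1 k)//= PoszD.
apply: (@le_trans _ _ (\sum_(i < n) M * `|A k i|)%N%:Z); last by rewrite lerDl.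
rewrite -(ler_int R) intr_norm (cone_coord k vy).
apply: (le_trans (ler_norm_sum _ _ _)).
rewrite -[X in _ <= X]/(_%:R) natr_sum; apply: ler_sum => i _.
have /andP[y0 yM'] := yM i.
rewrite normrM ger0_norm// natrM ler_pM// -intr_norm -abszE.
exact: lexx.
Qed.

(** [q] and [y] are the integer and fractional parts of the coefficients. The last clause presents
    the remainder as an integral vector, hence as a point of the zonotope to which finiteness
    applies. *)
Lemma cone_int_decomp v : cone_int R A v ->
  exists (q : 'I_n -> nat) (y : 'I_n -> R),
    [/\ forall i, 0 <= y i <= 1,
        map_mx intr v = \sum_(i < n) y i *: map_mx intr (col i A)
                        + \sum_(i < n) (q i)%:R *: map_mx intr (col i A)
      & map_mx intr (v - \sum_(i < n) col i A *+ q i) =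
        \sum_(i < n) y i *: map_mx intr (col i A)].
Proof.
move=> [x [x0 vx]]; exists (fun i => Num.truncn (x i)).
exists (fun i => x i - (Num.truncn (x i))%:R).
have E : map_mx intr v =
    \sum_(i < n) (x i - (Num.truncn (x i))%:R) *: map_mx intr (col i A)
    + \sum_(i < n) (Num.truncn (x i))%:R *: map_mx intr (col i A) :> 'cV[R]_d.
  by rewrite -big_split vx; apply: eq_bigr => i _; rewrite /= -scalerDl subrK.
split=> //.
- move=> i; have /andP[h1 h2] := truncn_itv (x0 i).
  by rewrite subr_ge0 h1 lerBlDl -natr1 in h2 *; rewrite ltW.
- rewrite raddfB /= E raddf_sum /=.
  under [X in _ - X]eq_bigr do rewrite raddfMn /= -scaler_nat.
  by rewrite addrK.
Qed.

Lemma finite_holes :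
  (forall v, cone_int R A v -> exists m, absorbed v m) ->
  finite_set (holes R A).
Proof.
move=> Kabs.
pose D M := (\sum_(j < d) \sum_(i < n) M * `|A j i|)%N.
(* All possible remainders lie in one finite box, so a single [M] absorbs them all. *)
have [M rM] : exists M, forall r, (cone_int R A `&`
    [set r | forall k, `|r k 0| <= (D 1%N)%:Z]) r -> absorbed r M.
  apply: finite_set_uniform_bound => [|r m m'|r [/Kabs//]].
  - by apply: sub_finite_set (finite_int_box d (D 1%N)) => r [].
  - exact: absorbed_leq.
apply: sub_finite_set (finite_int_box d (D M.+1)) => v [Kv nQv] k.
have [q [y [y01 vE rE]]] := cone_int_decomp Kv.
set r := v - _ in rE.
have Mr : absorbed r M.
  apply: rM; split.
    by exists y; split=> // i; case/andP: (y01 i).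
  by apply: cone_coord_bound rE.
have qM i : (q i < M)%N.
  rewrite ltnNge; apply/negP => Mq; apply: nQv.
  (* [M] of the [q i] copies of column [i] carry [r] into the semigroup; the remaining copies and
     the other columns already lie there. *)
  have -> : v = (r + col i A *+ M) +
      (col i A *+ (q i - M) + \sum_(j < n | j != i) col j A *+ q j).
    rewrite addrA -[_ + _ *+ (q i - M)]addrA -mulrnDr subnKC//.
    by rewrite -addrA /r (bigD1 i)//= subrK.
  apply: semigroupD; first exact: Mr.
  apply: semigroupD; first exact: semigroup_col.
  apply: (big_ind (semigroup A)) => [||j _].
  - exact: semigroup0.
  - exact: semigroupD.
  - exact: semigroup_col.
(* The full coefficients satisfy [y i + q i <= M + 1], whence the box of size [D M.+1]. *)
apply: (@cone_coord_bound (fun i => y i + (q i)%:R)).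
  move=> i; have /andP[y0 y1] := y01 i.
  by rewrite addr_ge0//= -natr1 addrC lerD// ler_nat ltnW.
by rewrite vE -big_split; apply: eq_bigr => i _; rewrite /= scalerDl.
Qed.

Lemma finite_holes_shifts b i :
  finite_set (holes R A) -> col i A != 0 -> cone_int R A b ->
  exists l, shifts A b i l.
Proof.
move=> finH ai0 Kb; apply: contrapT => noS.
(* A nonzero coordinate of the column makes [m |-> b + m a_i] injective, so the preimage of the
   finite set of holes is finite, although it would contain every natural number. *)
have [k ki] : exists k, A k i != 0.
  apply: contrapT => nA; move/eqP: ai0; apply; apply/colP => k.
  by rewrite !mxE; apply/eqP/negPn/negP => Aki; apply: nA; exists k.
apply: infinite_nat.
pose f m := b + col i A *+ m.
apply: (@sub_finite_set _ _ (f @^-1` holes R A)).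
  move=> m _; split; first exact: cone_int_shift.
  by move=> Qm; apply: noS; exists m%:Z; rewrite /shifts /= -pmulrn.
apply: finite_preimage finH => m m' _ _ /addrI/colP/(_ k).
by rewrite !mulmxnE !mxE => /(mulrIn ki).
Qed.

End Semigroup.

Theorem theorem3p7 (R : realType) (d n : nat) (A : 'M[int]_(d, n))
    (B : {fset 'cV[int]_d}) :
  lattice A = setT ->
  (exists c : 'cV[rat]_d,
     forall i : 'I_n, 0 < \sum_(k < d) c k 0 * (A k i)%:~R) ->
  minimal_Hilbert_basis R A B ->
  (finite_set (holes R A) <->
   forall b : 'cV[int]_d, b \in B -> forall i : 'I_n, (mu_bar A b i < +oo)%E).
Proof.
move=> _ [c cA] [[BK Bgen] _]; split=> [finH b bB i|mufin].
  apply/mu_bar_lty; apply: finite_holes_shifts finH _ (BK b bB).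
  (* On a zero column the form [c] would vanish, against its positivity. *)
  apply/eqP => /colP ai0; have := cA i.
  rewrite big1 ?ltxx// => k _.
  by have := ai0 k; rewrite !mxE => ->; rewrite mulr0.
apply: finite_holes => v /Bgen[x ->]; apply: absorbed_span => b bB.
by apply: absorbed_shifts => i; apply/mu_bar_lty; exact: mufin.
Qed.
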